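(* For every $n\ge1$, the map $$b_n:B_n\to\Big\{\sum_{i=0}^{n-1}a_i\,2^i i!\ :\ a_i\in\mathbb Z,\ 0\le a_i\le 2i+1\Big\},\qquad b_n(\pi)=\sum_{i=1}^{n}\mathrm{inv}_{n-i+1}(\pi)\,2^{i-1}(i-1)!,$$ is well defined and is a bijection.
   Context: $B_n$ is the hyperoctahedral group of signed permutations: bijections $\pi$ of $\{\pm1,\dots,\pm n\}$ with $\pi(-x)=-\pi(x)$; equivalently $\pi$ is determined by $(\pi(1),\dots,\pi(n))$ with $\pi(i)\in\{\pm1,\dots,\pm n\}$ and $(|\pi(1)|,\dots,|\pi(n)|)$ a permutation of $\{1,\dots,n\}$. For $i\in\{1,\dots,n\}$ the number of $i$-inversions of $\pi$ is: if $\pi(i)=j>0$, $\mathrm{inv}_i(\pi)=\#\{k\in\{i+1,\dots,n\}: |\pi(k)|<j\}$; if $\pi(i)=-j<0$, $\mathrm{inv}_i(\pi)=1+\#\{k\in\{i+1,\dots,n\}: |\pi(k)|<j\}+2\,\#\{k\in\{i+1,\dots,n\}: |\pi(k)|>j\}$. *)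

(* Defs.v *)
From mathcomp Require Import all_boot all_order all_algebra all_fingroup.
From mathcomp Require Import classical_sets functions.

Set Implicit Arguments.
Unset Strict Implicit.
Unset Printing Implicit Defensive.

Import Order.TTheory GRing.Theory Num.Theory.

Local Open Scope ring_scope.

(* The alphabet {+-1, ..., +-n}: (s, i) stands for i + 1 when s = false and    *)
(* for -(i + 1) when s = true. Since ordinals start at 0, i : 'I_n also stands *)
(* for the position i + 1 in {1, ..., n}.                                      *)
Definition letter (n : nat) : finType := (bool * 'I_n)%type.

Definition letter_val (n : nat) (x : letter n) : int :=
  (-1) ^+ x.1 * (x.2.+1)%:Z.

Definition letter_opp (n : nat) (x : letter n) : letter n := (~~ x.1, x.2).

Lemma letter_val_inj (n : nat) : injective (@letter_val n).
Proof.
move=> [[] i] [[] j]; rewrite /letter_val /= ?expr1 ?expr0 ?mul1r ?mulN1r.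
- by move=> /oppr_inj [] /val_inj ->.
- by [].
- by [].
- by move=> [] /val_inj ->.
Qed.

Lemma letter_val_opp (n : nat) (x : letter n) :
  letter_val (letter_opp x) = - letter_val x.
Proof. by case: x => [[] i]; rewrite /letter_val /= ?expr1 ?expr0 ?mulN1r ?mul1r ?opprK. Qed.

Lemma letter_valP (n : nat) (m : int) :
  (exists x : letter n, letter_val x = m) <-> (0 < `|m| <= n)%N.
Proof.
split=> [[[s i] <-]|/andP[m0 mn]].
  by rewrite /letter_val abszMsign /= ltn_ord.
have im : (`|m|.-1 < n)%N by rewrite prednK.
exists (m < 0, Ordinal im).
by rewrite /letter_val /= prednK // -intEsign.
Qed.

Definition hyperoctahedral (n : nat) : {set {perm letter n}} :=
  [set p : {perm letter n} |
    [forall x, p (letter_opp x) == letter_opp (p x)]].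

Definition window (n : nat) (p : {perm letter n}) (i : 'I_n) : int :=
  letter_val (p (false, i)).

Definition inv (n : nat) (p : {perm letter n}) (i : 'I_n) : nat :=
  let j := `|window p i|%N in
  let smaller := #|[set k : 'I_n | (i < k)%N & (`|window p k| < j)%N]| in
  let larger := #|[set k : 'I_n | (i < k)%N & (j < `|window p k|)%N]| in
  if 0 < window p i then smaller else (1 + smaller + 2 * larger)%N.

(* With i = j + 1, the position n - i + 1 has 0-based index n - 1 - j, which   *)
(* is rev_ord j.                                                               *)
Definition bmap (n : nat) (p : {perm letter n}) : int :=
  \sum_(j < n) (inv p (rev_ord j))%:Z * 2 ^+ j * (j`!)%:Z.

Definition target (n : nat) : set int :=
  [set m : int | exists a : 'I_n -> int,
    (forall i : 'I_n, 0 <= a i <= 2 * (i : nat)%:Z + 1) /\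
    m = \sum_(i < n) a i * 2 ^+ i * (i`!)%:Z]%classic.

(* Main.v *)
(** A negative letter followed by [j] letters, [s] of them smaller in absolute
    value, has [1 + s + 2 (j - s) = 2 j + 1 - s] inversions, whereas a positive
    one has [s <= j].  So the number of inversions at a position encodes exactly
    the sign and the entry [s] of the Lehmer code of [|pi|], which together
    determine [pi].  As the expansion in the weights [2 ^ i * i!] is unique,
    [bmap] is injective with values in the interval [0, 2 ^ n * n!).  The group
    has at least [2 ^ n * n!] elements, so every integer of that interval,
    in particular every element of the target, is reached. *)
Require Import Defs.
From mathcomp Require Import all_boot all_order all_algebra all_fingroup.
From mathcomp Require Import classical_sets functions.
From mathcomp Require Import zify.

Set Implicit Arguments.
Unset Strict Implicit.
Unset Printing Implicit Defensive.

Import GRing.Theory Num.Theory.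

(** * Mixed radix expansions with weights [2 ^ i * i!] *)

Definition radix_sum (n : nat) (d : 'I_n -> nat) : nat :=
  \sum_(i < n) d i * (2 ^ i * i`!).

Lemma radix_sum_recr (n : nat) (d : 'I_n.+1 -> nat) :
  radix_sum d =
  d ord_max * (2 ^ n * n`!) + radix_sum (fun i => d (widen_ord (leqnSn n) i)).
Proof. by rewrite /radix_sum big_ord_recr addnC. Qed.

(** Consecutive weights have ratio [2 (i + 1)], so [2 i + 1] is the largest digit allowed at place
    [i], as in any mixed radix system. *)
Lemma radix_sum_lt (n : nat) (d : 'I_n -> nat) :
  (forall i, d i <= i.*2.+1) -> radix_sum d < 2 ^ n * n`!.
Proof.
elim: n d => [|n IHn] d dP; first by rewrite /radix_sum big_ord0.
have lt_low := IHn _ (fun i => dP (widen_ord (leqnSn n) i)).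
have := leq_mul (dP ord_max) (leqnn (2 ^ n * n`!)).
rewrite radix_sum_recr expnS factS /=.
have -> : 2 * 2 ^ n * (n.+1 * n`!) = n.+1.*2 * (2 ^ n * n`!).
  by rewrite mulnACA mul2n.
rewrite doubleS [n.*2.+2 * _]mulSn; lia.
Qed.

Lemma radix_sum_inj (n : nat) (d e : 'I_n -> nat) :
    (forall i, d i <= i.*2.+1) -> (forall i, e i <= i.*2.+1) ->
  radix_sum d = radix_sum e -> d =1 e.
Proof.
elim: n d e => [|n IHn] d e dP eP; first by move=> _ [].
rewrite !radix_sum_recr => eq_de.
have dlt := radix_sum_lt (fun i => dP (widen_ord (leqnSn n) i)).
have elt := radix_sum_lt (fun i => eP (widen_ord (leqnSn n) i)).
(* The lower digits sum to less than the top weight, so Euclidean division by that weight returns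
   the top digit and the lower part. *)
have := edivn_eq (d ord_max) dlt; rewrite eq_de edivn_eq // => -[eq_top eq_low].
move=> i; case: (unliftP ord_max i) => [j|] -> //.
have -> : lift ord_max j = widen_ord (leqnSn n) j.
  by apply/val_inj; rewrite /= /bump leqNgt ltn_ord.
by apply: (IHn _ _ _ _ (esym eq_low)) => k; [apply: dP | apply: eP].
Qed.

Lemma Posz_radix_sum (n : nat) (d : 'I_n -> nat) :
  Posz (radix_sum d) = (\sum_(i < n) Posz (d i) * 2 ^+ i * Posz i`!)%R.
Proof.
rewrite /radix_sum -[LHS]natz natr_sum; apply: eq_bigr => i _.
by rewrite [LHS]natz mulnA !PoszM -[Posz (2 ^ i)]natz natrX.
Qed.

(** * Lehmer codes of permutations *)

Definition lehmer (n : nat) (s : 'S_n) (i : 'I_n) : nat :=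
  #|[set k : 'I_n | (i < k) && (s k < s i)]|.

Definition colehmer (n : nat) (s : 'S_n) (i : 'I_n) : nat :=
  #|[set k : 'I_n | (i < k) && (s i < s k)]|.

(** Exactly [j] positions follow [rev_ord j], and by injectivity of [s] each of them carries either
    a smaller or a larger value. *)
Lemma lehmerD (n : nat) (s : 'S_n) (j : 'I_n) :
  lehmer s (rev_ord j) + colehmer s (rev_ord j) = j.
Proof.
set i := rev_ord j.
have -> : lehmer s i + colehmer s i =
          #|[set k : 'I_n | (i < k) && (s k < s i)] :|:
            [set k : 'I_n | (i < k) && (s i < s k)]|.
  rewrite /lehmer /colehmer -cardsUI [X in _ + X]eq_card0 ?addn0 // => k.
  by rewrite !inE; lia.
set A := _ :|: _.
have -> : A = [set rev_ord k | k in [set k : 'I_n | k < j]].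
  apply/finset.setP=> k; rewrite -[k]rev_ordK mem_imset ?inE; last exact: rev_ord_inj.
  have -> : (i < rev_ord (rev_ord k)) = (rev_ord k < j).
    by rewrite /=; have := ltn_ord k; have := ltn_ord j; lia.
  have [lt_kj|] := ltnP (rev_ord k) j; last by rewrite /=; lia.
  suff : s (rev_ord (rev_ord k)) != s i :> nat by lia.
  apply: contraTneq lt_kj => /val_inj/perm_inj/rev_ord_inj ->.
  by rewrite ltnn.
rewrite card_imset; last exact: rev_ord_inj.
have -> : [set k : 'I_n | k < j] = [set widen_ord (ltnW (ltn_ord j)) k | k : 'I_j].
  apply/finset.setP=> k; rewrite inE; apply/idP/imsetP=> [lt_kj|[l _ ->]] /=.
    by exists (Ordinal lt_kj) => //; apply/val_inj.
  exact: ltn_ord.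
rewrite card_imset ?card_ord // => k l /(congr1 val) /= ?.
exact/val_inj.
Qed.

Lemma lehmer_lt (n : nat) (s t : 'S_n) (i : 'I_n) :
    (forall k : 'I_n, k < i -> s k = t k) -> s i < t i ->
  lehmer s i < lehmer t i.
Proof.
move=> eq_st lt_st; set A := [set k : 'I_n | (i < k) && (s k < s i)].
have -> : (lehmer s i).+1 = #|i |: A| by rewrite cardsU1 inE ltnn.
(* [k |-> t^-1 (s k)] embeds [i |: A] into the positions counted by [lehmer t i]:
   a value [s k] with [i <= k] cannot be taken by [t] before position [i]. *)
have f_inj : injective (fun k => (t^-1)%g (s k)).
  by move=> k l /perm_inj/perm_inj.
rewrite -(card_imset _ f_inj); apply/subset_leq_card/fintype.subsetP=> l.
case/imsetP=> k; rewrite !inE => kA def_l.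
have tl : t l = s k by rewrite def_l permKV.
have [le_ik le_s] : i <= k /\ s k <= s i.
  by case/orP: kA => [/eqP->|/andP[? ?]]; split=> //; apply: ltnW.
rewrite tl (leq_ltn_trans le_s lt_st) andbT.
case: ltngtP => // [lt_li|/val_inj eq_il].
  by have := eq_st _ lt_li; rewrite tl => /perm_inj eq_lk; rewrite eq_lk in lt_li; lia.
by move: lt_st; rewrite eq_il tl -eq_il; lia.
Qed.

(** At the first position where [s] and [t] differ, [lehmer_lt] would separate their codes. *)
Lemma lehmer_inj (n : nat) (s t : 'S_n) : lehmer s =1 lehmer t -> s = t.
Proof.
move=> eq_L; apply/permP=> i.
have [m] := ubnP (val i); elim: m i => // m IHm i; rewrite ltnS => le_im.
have eq_st (k : 'I_n) : k < i -> s k = t k.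
  by move=> lt_ki; apply: IHm; apply: leq_trans le_im.
apply/val_inj; case: (ltngtP (s i) (t i)) => // [lt_st|lt_ts].
  by have := lehmer_lt eq_st lt_st; rewrite eq_L ltnn.
have eq_ts (k : 'I_n) : k < i -> t k = s k by move/eq_st.
by have := lehmer_lt eq_ts lt_ts; rewrite eq_L ltnn.
Qed.

(** * Signed permutations and their inversion numbers *)

Section SignedPermutations.
Variable n : nat.
Implicit Types p q : {perm letter n}.

Lemma hyperoctahedralP p :
  reflect (forall x, p (letter_opp x) = letter_opp (p x)) (p \in hyperoctahedral n).
Proof. by rewrite inE; apply: (iffP forallP) => pN x; apply/eqP; rewrite pN. Qed.

(** If the images of two positive letters agree up to sign, they are equal, or [p] takes the same
    value at one letter and at the opposite of the other. *)
Lemma abs_part_inj p :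
  p \in hyperoctahedral n -> injective (fun i => (p (false, i)).2).
Proof.
move/hyperoctahedralP=> pN i j /= eq_ij.
case: (eqVneq (p (false, i)).1 (p (false, j)).1) => [eq_s|ne_s].
  suff /perm_inj [] : p (false, i) = p (false, j) by [].
  by rewrite [LHS]surjective_pairing eq_s eq_ij -surjective_pairing.
suff /perm_inj [] : p (false, i) = p (letter_opp (false, j)) by [].
rewrite pN [LHS]surjective_pairing eq_ij /letter_opp.
by case: (p (false, i)).1 ne_s; case: (p (false, j)).1.
Qed.

(** The flag [e i] marks a negative entry at [i]; adding it to the sign of [x] makes the map commute
    with [letter_opp]. *)
Definition signed_fun (s : 'S_n) (e : {ffun 'I_n -> bool}) (x : letter n) :
  letter n := (x.1 (+) e x.2, s x.2).

Lemma signed_fun_inj s e : injective (signed_fun s e).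
Proof. by move=> [a i] [b j] [] /= + /perm_inj eq_ij; rewrite eq_ij => /addIb ->. Qed.

Definition signed_perm s e : {perm letter n} := perm (@signed_fun_inj s e).

Lemma signed_perm_hyperoctahedral s e : signed_perm s e \in hyperoctahedral n.
Proof.
by apply/hyperoctahedralP=> x; rewrite !permE /signed_fun /letter_opp /= addNb.
Qed.

Lemma signed_perm_inj s e s' e' :
  signed_perm s e = signed_perm s' e' -> (s, e) = (s', e').
Proof.
move/permP=> eq_p; congr (_, _).
  by apply/permP=> i; have := eq_p (false, i); rewrite !permE => -[].
by apply/ffunP=> i; have := eq_p (false, i); rewrite !permE => -[].
Qed.

Lemma signed_permP p :
  p \in hyperoctahedral n -> exists s e, p = signed_perm s e.
Proof.
move=> pH; exists (perm (abs_part_inj pH)), [ffun i => (p (false, i)).1].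
have /hyperoctahedralP pN := pH.
apply/permP=> -[b i]; rewrite permE /signed_fun /= permE ffunE.
case: b; last by rewrite -surjective_pairing.
by rewrite -[(true, i)]/(letter_opp (false, i)) pN.
Qed.

Lemma leq_card_hyperoctahedral : 2 ^ n * n`! <= #|hyperoctahedral n|.
Proof.
have -> : 2 ^ n * n`! = #|{: 'S_n * {ffun 'I_n -> bool}}|.
  by rewrite card_prod card_ffun card_bool card_ord card_Sn mulnC.
rewrite -cardsT -(@card_imset _ _ (fun se => signed_perm se.1 se.2)).
  apply/subset_leq_card/fintype.subsetP=> _ /imsetP[se _ ->].
  exact: signed_perm_hyperoctahedral.
by move=> [s e] [s' e'] /signed_perm_inj.
Qed.

Lemma inv_signed_perm s e (j : 'I_n) :
  let i := rev_ord j in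
  Defs.inv (signed_perm s e) i =
  if e i then (j.*2.+1 - lehmer s i)%N else lehmer s i.
Proof.
move=> i; have absW k : `|window (signed_perm s e) k|%N = (s k).+1.
  by rewrite /window /letter_val abszMsign permE.
have -> : Defs.inv (signed_perm s e) i =
          if e i then 1 + lehmer s i + 2 * colehmer s i else lehmer s i.
  rewrite /Defs.inv /lehmer /colehmer absW.
  under eq_finset do rewrite absW ltnS.
  under [in X in 2 * X]eq_finset do rewrite absW ltnS.
  by rewrite /window permE /signed_fun /letter_val /=; case: (e i).
(* Substituting [colehmer s i = j - lehmer s i] gives the formula; since [lehmer s i <= j], the
   subtraction is not truncated. *)
by have := lehmerD s j; rewrite -/i; case: (e i) => //; lia.
Qed.

Lemma inv_le p (j : 'I_n) :
  p \in hyperoctahedral n -> Defs.inv p (rev_ord j) <= j.*2.+1.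
Proof.
case/signed_permP=> s [e ->]; rewrite inv_signed_perm.
by have := lehmerD s j; case: (e _); lia.
Qed.

Lemma inv_inj p q :
    p \in hyperoctahedral n -> q \in hyperoctahedral n ->
  Defs.inv p =1 Defs.inv q -> p = q.
Proof.
case/signed_permP=> s [e ->] /signed_permP[t [f ->]] eq_inv.
have eq_code i : e i = f i /\ lehmer s i = lehmer t i.
  have := eq_inv i; rewrite -[i]rev_ordK !inv_signed_perm.
  (* With [j = rev_ord i], positive entries give values at most [j] and negative ones at least
     [j + 1], so the sign can be read off first. *)
  have := lehmerD s (rev_ord i); have := lehmerD t (rev_ord i).
  by case: (e _); case: (f _); lia.
have -> : e = f by apply/ffunP=> i; case: (eq_code i).
by have -> : s = t by apply: lehmer_inj => i; case: (eq_code i).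
Qed.

Definition code p : nat := radix_sum (fun j => Defs.inv p (rev_ord j)).

Lemma bmapE p : bmap p = Posz (code p).
Proof. by rewrite /code Posz_radix_sum. Qed.

Lemma code_lt p : p \in hyperoctahedral n -> code p < 2 ^ n * n`!.
Proof. by move=> pH; apply: radix_sum_lt => j; apply: inv_le. Qed.

Lemma code_inj : {in hyperoctahedral n &, injective code}.
Proof.
move=> p q pH qH eq_pq; apply: inv_inj => // i; rewrite -[i]rev_ordK.
by apply: (radix_sum_inj _ _ eq_pq) => j; apply: inv_le.
Qed.

Lemma code_surj m :
  m < 2 ^ n * n`! -> exists2 p, p \in hyperoctahedral n & code p = m.
Proof.
move=> lt_m.
(* The default value is never taken on the group, by [code_lt]. There [f] is injective into a type
   no larger than the group, hence onto. *)
pose f p : 'I_(2 ^ n * n`!) := insubd (Ordinal lt_m) (code p).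
have fE p : p \in hyperoctahedral n -> f p = code p :> nat.
  by move=> pH; rewrite val_insubd code_lt.
have f_inj : {in hyperoctahedral n &, injective f}.
  by move=> p q pH qH /(congr1 val) /=; rewrite !fE //; apply: code_inj.
have /eqP f_onto : f @: hyperoctahedral n == [set: _]%SET.
  rewrite eqEcard finset.subsetT cardsT card_ord card_in_imset //.
  exact: leq_card_hyperoctahedral.
have : Ordinal lt_m \in f @: hyperoctahedral n by rewrite f_onto inE.
by case/imsetP=> p pH def_m; exists p => //; rewrite -fE // -def_m.
Qed.

End SignedPermutations.

Lemma target_radix_sum (n : nat) (m : int) :
  target n m <->
  exists2 d : 'I_n -> nat, (forall i, d i <= i.*2.+1) & m = Posz (radix_sum d).
Proof.
split=> [[a [aP ->]]|[d dP ->]]; last first.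
  exists (fun i => Posz (d i)); split; last exact: Posz_radix_sum.
  by move=> i; have := dP i; lia.
(* The digits [a i] are nonnegative, so absolute values preserve them. *)
exists (fun i => `|a i|%N); first by move=> i; have := aP i; lia.
rewrite Posz_radix_sum; apply: eq_bigr => i _; rewrite gez0_abs //.
by case/andP: (aP i).
Qed.

Theorem theorem3p5 (n : nat) (hn : (1 <= n)%N) :
  set_bij [set` hyperoctahedral n]%classic (target n) (@bmap n).
Proof.
split.
- move=> p /= pH; apply/target_radix_sum.
  by exists (fun j => Defs.inv p (rev_ord j)) => [j|]; [apply: inv_le | apply: bmapE].
- move=> p q; rewrite !in_setE /= !bmapE => pH qH [].
  exact: code_inj.
(* An element of the target is a radix sum, so it lies below [2 ^ n * n!] and is the code of some
   [p]. *)
- move=> m /target_radix_sum[d /radix_sum_lt/code_surj[p pH <-] ->].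
  by exists p; rewrite ?bmapE.
Qed.
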